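(* Let $X$ be Hilbert and let the Lipschitz-regularizer assumption in the context hold. Let $q\in W$, $t>0$, and $\gamma>0$ with $\gamma t\|T\|^2\le1$, and let $(y^j,\mu^j)_{j\ge0}$ be generated from $\mu^0\in\operatorname{dom}R^*$ by $$y^j=q-tT^\star\mu^j,\qquad \mu^{j+1}=\operatorname{prox}_{\gamma R^*}(\mu^j+\gamma Ty^j).$$ Define, for $j\ge1$, $\overline y^{\,j}=\frac1j\sum_{i=0}^{j-1}y^i$. Then, for $j\ge1$, $$0\le\mathcal G_{q,t}(\overline y^{\,j},\mu^j)\le\frac{(\|\mu^0\|_X+L_R)^2}{2\gamma j}\le\frac{2L_R^2}{\gamma j}.$$ In particular, the pairs $(\overline y^{\,j},\mu^j)$ also satisfy the inner approximation property (stated in the context).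
   Context: $W,X$ are real Hilbert spaces, $T:W\to X$ is bounded and linear, $T^\star:X\to W$ its Hilbert adjoint; dual vectors are identified with elements $\mu\in X$. Lipschitz-regularizer assumption: $R:X\to\mathbb R$ is (finite) convex and globally Lipschitz with constant $L_R<\infty$; the values of $R$, finite values of $R^*$, and the proximal map of $R^*$ in $X$ can be evaluated (a computational availability assumption); a starting point $\mu^0\in\operatorname{dom}R^*$ is available. Here $R^*(\mu)=\sup_{x\in X}((\mu,x)_X-R(x))$, and $\operatorname{prox}_{\gamma R^*}(\nu)$ is the unique minimizer over $\mu\in X$ of $R^*(\mu)+\frac1{2\gamma}\|\mu-\nu\|_X^2$. $\Psi_{q,t}(y)=\frac1{2t}\|y-q\|_W^2+R(Ty)$ and $H(\mu)=\frac t2\|T^\star\mu\|_W^2-(\mu,Tq)_X+R^*(\mu)$ (the negative of the dual objective). The gap is $\mathcal G_{q,t}(y,\mu)=\Psi_{q,t}(y)+H(\mu)$. Inner approximation property: with $\varphi=R\circ T$ and $f:W\to\mathbb R$ continuously Fréchet differentiable with globally Lipschitz Hilbert gradient $\nabla f$, for every $w\in\operatorname{dom}\varphi$ and $t>0$, with $q=w-t\nabla f(w)$, the produced pairs have finite gaps tending to zero, and the gap (or a rigorous upper bound tending to zero) is available for testing. *)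

(* Defs.v *)
From HB Require Import structures.
From mathcomp Require Import all_boot all_order all_algebra.
From mathcomp Require Import all_classical all_reals all_analysis.

Set Implicit Arguments.
Unset Strict Implicit.
Unset Printing Implicit Defensive.

Import Order.TTheory GRing.Theory Num.Theory.
Import numFieldNormedType.Exports.

Local Open Scope classical_set_scope.
Local Open Scope ring_scope.

(* [dotp] is a positive definite symmetric bilinear form (conjugation [idfun]);
   [dotp_norm] makes the Banach norm and topology those of the inner product. *)
HB.mixin Record CompleteNormedModule_isHilbert (K : realType) V
    & CompleteNormedModule K V := {
  dotp : {dot V for @idfun K} ;
  dotp_norm : forall u : V, dotp u u = `|u| ^+ 2
}.

#[short(type="hilbertType")]
HB.structure Definition Hilbert (K : realType) :=
  {V of CompleteNormedModule K V & CompleteNormedModule_isHilbert K V}.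

Definition inner (K : realType) (V : hilbertType K) (u v : V) : K := dotp u v.

Section Operators.
Variables (K : realType) (W X : hilbertType K).
Implicit Type T : {linear W -> X}.

Definition bounded_operator T := exists M : K, forall w, `|T w| <= M * `|w|.

Definition opnorm T : K := sup [set `|T w| | w in [set w | `|w| <= 1]].

(* For bounded [T] exactly one [z] qualifies, by the Riesz theorem. *)
Definition adjoint T (x : X) : W :=
  get [set z | forall w, inner (T w) x = inner w z].

End Operators.

Section ConvexAnalysis.
Variables (K : realType) (X : hilbertType K).

Definition edom (V : Type) (F : V -> \bar K) : set V := [set v | (F v < +oo)%E].

Definition conjugate (R : X -> K) (mu : X) : \bar K :=
  ereal_sup [set (inner mu x - R x)%:E | x in [set: X]].

Definition prox_objective (gamma : K) (F : X -> \bar K) (nu mu : X) : \bar K :=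
  (F mu + ((2 * gamma)^-1 * `|mu - nu| ^+ 2)%:E)%E.

(* For [0 < gamma] and [F] proper, convex and lower semicontinuous, the
   minimizer exists and is unique. *)
Definition prox (gamma : K) (F : X -> \bar K) (nu : X) : X :=
  get [set p | forall mu,
    (prox_objective gamma F nu p <= prox_objective gamma F nu mu)%E].

End ConvexAnalysis.

Section SmoothFunctions.
Variables (K : realType) (W : hilbertType K).

Definition gradient (f : W -> K) (w : W) : W :=
  get [set g | forall h, 'd f w h = inner g h].

Definition C1_lipschitz_gradient (f : W -> K) :=
  [/\ forall w, differentiable f w,
      continuous (gradient f) &
      lipschitz (gradient f)].

End SmoothFunctions.

Section Gap.
Variables (K : realType) (W X : hilbertType K).
Variables (T : {linear W -> X}) (R : X -> K).
Implicit Types (q y : W) (mu : X) (t gamma : K).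

Definition primal_objective q t y : K :=
  (2 * t)^-1 * `|y - q| ^+ 2 + R (T y).

(* the negative of the dual objective *)
Definition dual_objective q t mu : \bar K :=
  ((t / 2 * `|adjoint T mu| ^+ 2 - inner mu (T q))%:E + conjugate R mu)%E.

Definition gap q t y mu : \bar K :=
  ((primal_objective q t y)%:E + dual_objective q t mu)%E.

Definition primal_of_dual q t mu : W := q - t *: adjoint T mu.

Fixpoint dual_iterate q t gamma (mu0 : X) (j : nat) : X :=
  if j is i.+1 then
    let mu := dual_iterate q t gamma mu0 i in
    prox gamma (conjugate R) (mu + gamma *: T (primal_of_dual q t mu))
  else mu0.

Definition primal_iterate q t gamma mu0 (j : nat) : W :=
  primal_of_dual q t (dual_iterate q t gamma mu0 j).

(* Meaningful for [0 < j]. *)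
Definition primal_average q t gamma mu0 (j : nat) : W :=
  j%:R^-1 *: \sum_(i < j) primal_iterate q t gamma mu0 i.

(* [pairs q t] is the sequence of pairs produced for the subproblem [(q, t)],
   and [bound q t] the sequence of upper bounds on their gaps that is used for
   testing; [bound] is an explicit argument so that the bound has to be exhibited
   rather than merely exist. *)
Definition inner_approximation (f : W -> K)
    (pairs : W -> K -> nat -> W * X) (bound : W -> K -> nat -> K) :=
  forall (w : W) (t : K), edom (fun v => (R (T v))%:E) w -> 0 < t ->
  let q := w - t *: gradient f w in
  let g := fun n => gap q t (pairs q t n).1 (pairs q t n).2 in
  [/\ forall n, g n \is a fin_num,
      g @ \oo --> 0%E,
      forall n, (g n <= (bound q t n)%:E)%E &
      bound q t @ \oo --> (0 : K)].

End Gap.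

(* Main.v *)
Require Import Defs.
From HB Require Import structures.
From mathcomp Require Import all_boot all_order all_algebra.
From mathcomp Require Import all_classical all_reals all_analysis.
From mathcomp Require Import ring lra.

Set Implicit Arguments.
Unset Strict Implicit.
Unset Printing Implicit Defensive.

Import Order.TTheory GRing.Theory Num.Theory.
Import numFieldNormedType.Exports.

Local Open Scope classical_set_scope.
Local Open Scope ring_scope.

(** The iteration is the proximal gradient method applied to the dual
objective H: its smooth part has gradient [- T (y j)] at [mu j] and a
quadratic remainder that the step size condition bounds by
[`|mu j - mu j.+1| ^+ 2 / (2 * gamma)] ([dual_smoothness]).  The usual one-step
inequality, tested against an arbitrary [nu] in the domain of [R^*], bounds
[H (mu j.+1)] by means of the value at [nu] of the minorant of H obtained by
linearizing its smooth part at [mu j].  That value is the negative of the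
Lagrangian [`|y j - q| ^+ 2 / (2 * t) + <nu, T (y j)> - R^* nu], so that
    [`|y j - q| ^+ 2 / (2 * t) + <nu, T (y j)> - R^* nu + H (mu j.+1)
      <= (`|nu - mu j| ^+ 2 - `|nu - mu j.+1| ^+ 2) / (2 * gamma)]
([proximal_gradient_step]).  With [nu := mu j] it shows that H decreases along
the iterates; summing over j telescopes the right-hand side, and convexity of
the squared norm replaces the primal iterates by their average
([averaged_gap_estimate]).  Choosing for [nu] a subgradient of R at [T ybar]
turns [<nu, T ybar> - R^* nu] into [R (T ybar)], hence the left-hand side into
the gap, and [nu] and [mu0] both have norm at most [`|L|] since a Lipschitz
function has a conjugate with bounded domain ([edom_conjugate_norm_le]).
Nonnegativity of the gap is the Fenchel-Young inequality and a completed square.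

All existence questions reduce to one fact, [proximal_point]: a finite convex
Lipschitz function plus a multiple of a squared distance attains its minimum,
and the minimizer satisfies the expected subgradient inequality.  Applied to a
linear functional it is the Riesz theorem, hence the adjoint ([adjointP]).
Applied to R it gives the proximal map of [R^*] through the Moreau
decomposition ([proxP]).  Applied to R with large weights it gives points of
the domain of [R^*] that are subgradients of R at a given point up to any error
([approximate_subgradient]); letting the error tend to 0 gives the gap
bound. *)

(** * Inner products *)

Section InnerProduct.
Variables (K : realType) (V : hilbertType K).
Implicit Types (u v w : V) (a : K).

Lemma innerC u v : inner u v = inner v u.
Proof. by rewrite /inner hermC expr0 mul1r. Qed.

Lemma innerDl u v w : inner (u + v) w = inner u w + inner v w.
Proof. exact: linearDl. Qed.

Lemma innerNl u w : inner (- u) w = - inner u w.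
Proof. exact: linearNl. Qed.

Lemma innerZl a u w : inner (a *: u) w = a * inner u w.
Proof. exact: linearZl_LR. Qed.

Lemma innerDr u v w : inner w (u + v) = inner w u + inner w v.
Proof. exact: linearDr. Qed.

Lemma innerNr u w : inner w (- u) = - inner w u.
Proof. exact: linearNr. Qed.

Lemma innerZr a u w : inner w (a *: u) = a * inner w u.
Proof. by rewrite innerC innerZl innerC. Qed.

Definition innerE := (innerDl, innerDr, innerNl, innerNr, innerZl, innerZr).

Lemma inner0r u : inner u 0 = 0.
Proof. exact: linear0r. Qed.

Lemma inner_sumr n (F : 'I_n -> V) w :
  inner w (\sum_(i < n) F i) = \sum_(i < n) inner w (F i).
Proof. exact: linear_sumr. Qed.

Lemma sqr_norm u : `|u| ^+ 2 = inner u u.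
Proof. by rewrite /inner dotp_norm. Qed.

Lemma inner_ge0 u : 0 <= inner u u.
Proof. by rewrite -sqr_norm sqr_ge0. Qed.

Lemma inner_eq0 u : inner u u <= 0 -> u = 0.
Proof.
rewrite -sqr_norm => u0; apply/eqP; rewrite -normr_eq0 -sqrf_eq0.
by rewrite eq_le u0 sqr_ge0.
Qed.

(** Cauchy-Schwarz, from the squared norm of [`|v| *: u - `|u| *: v]. *)
Lemma inner_le_norm u v : inner u v <= `|u| * `|v|.
Proof.
have [->|v0] := eqVneq v 0; first by rewrite inner0r normr0 mulr0.
have nv : 0 < `|v| by rewrite normr_gt0.
have := inner_ge0 (`|v| *: u - `|u| *: v).
rewrite !innerE (innerC v u) -!sqr_norm => H.
have [u0|u0] := eqVneq u 0.
  by rewrite u0 innerC inner0r normr0 mul0r.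
have nu : 0 < `|u| by rewrite normr_gt0.
have pos : 0 < `|u| * `|v| by rewrite mulr_gt0.
rewrite -(ler_pM2l pos); nra.
Qed.

Lemma norm_inner_le u v : `|inner u v| <= `|u| * `|v|.
Proof.
rewrite ler_norml inner_le_norm andbT lerNl -innerNl.
by rewrite (le_trans (inner_le_norm _ _))// normrN.
Qed.

(** Jensen's inequality for the squared distance to [q]: the two sides differ by
the sum of the squared deviations of the [F i] from their mean. *)
Lemma sqr_norm_average n (F : 'I_n -> V) q : (0 < n)%N ->
  n%:R * `|n%:R^-1 *: (\sum_(i < n) F i) - q| ^+ 2
    <= \sum_(i < n) `|F i - q| ^+ 2.
Proof.
move=> n0; set b := n%:R^-1 *: _ - q.
have nneq0 : n%:R != 0 :> K by rewrite pnatr_eq0 -lt0n.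
have sumE : \sum_(i < n) (F i - q) = n%:R *: b.
  rewrite big_split /= sumr_const card_ord scalerBr scalerA divff // scale1r.
  by rewrite scaler_nat mulNrn.
clearbody b.
have : 0 <= \sum_(i < n) `|F i - q - b| ^+ 2.
  by apply: sumr_ge0 => i _; exact: sqr_ge0.
rewrite (eq_bigr (fun i =>
    `|F i - q| ^+ 2 + (inner b b - 2 * inner b (F i - q)))).
  rewrite big_split /= sumrB sumr_const card_ord -mulr_sumr -inner_sumr sumE.
  rewrite innerZr -mulr_natl sqr_norm; lra.
move=> i _; rewrite !sqr_norm; move: (F i - q) => u.
by rewrite !innerE (innerC u b); ring.
Qed.

End InnerProduct.

(** * Proximal points of Lipschitz convex functions *)

Section ProximalPoint.
Variables (K : realType) (X : hilbertType K) (R : X -> K) (L : K).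
Hypothesis R_convex : convex_function [set: X] R.
Hypothesis R_lipschitz : L.-lipschitz R.

Lemma lipschitz_normB x y : `|R x - R y| <= L * `|x - y|.
Proof. by have := @R_lipschitz (x, y); apply. Qed.

Lemma lipschitz_le_abs x y : R x - R y <= `|L| * `|x - y|.
Proof.
apply: (le_trans (ler_norm _)); apply: (le_trans (lipschitz_normB x y)).
by rewrite ler_wpM2r // ler_norm.
Qed.

Lemma convex_segment x y s : 0 <= s -> s <= 1 ->
  R (s *: x + (1 - s) *: y) <= s * R x + (1 - s) * R y.
Proof.
move=> s0 s1.
exact: (@R_convex (Itv01 s0 s1) x y (mem_set I) (mem_set I)).
Qed.

Lemma lipschitz_continuous : continuous R.
Proof.
move=> x; apply/cvgrPdist_le => e e0.
have L1 : 0 < `|L| + 1 by rewrite ltr_wpDl.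
near=> y.
apply: (le_trans (lipschitz_normB x y)).
have : `|x - y| <= e / (`|L| + 1).
  by near: y; apply: cvgr_dist_le => //; exact: divr_gt0.
rewrite ler_pdivlMr // => H; apply: le_trans H.
rewrite mulrC ler_wpM2l //; have := ler_norm L; lra.
Unshelve. all: by end_near. Qed.

(** A negative Lipschitz constant is possible, but only on the trivial space. *)
Lemma lipschitz_neg_trivial (x : X) : L < 0 -> x = 0.
Proof.
move=> L0; apply/eqP; rewrite -normr_eq0 eq_le normr_ge0 andbT.
have := le_trans (normr_ge0 _) (lipschitz_normB x 0).
by rewrite subr0 nmulr_rge0.
Qed.

Definition moreau (c : K) (z x : X) : K := R x + c / 2 * `|x - z| ^+ 2.

(** The linear growth allowed by the Lipschitz condition is absorbed by the
square: complete the square in [`|x - z|]. *)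
Lemma moreau_lower_bound c z x : 0 < c ->
  R z - `|L| ^+ 2 / (2 * c) <= moreau c z x.
Proof.
move=> c0; have := lipschitz_le_abs z x; rewrite distrC => H.
have H2 : 0 <= (c * `|x - z| - `|L|) ^+ 2 / (2 * c).
  by rewrite divr_ge0 ?sqr_ge0 // mulr_ge0 // ltW.
rewrite /moreau.
have -> : c / 2 * `|x - z| ^+ 2 = (c * `|x - z| - `|L|) ^+ 2 / (2 * c)
   + `|L| * `|x - z| - `|L| ^+ 2 / (2 * c) by field; lra.
lra.
Qed.

(** The gain over midpoint convexity comes from the parallelogram identity; it
is what makes minimizing sequences Cauchy. *)
Lemma moreau_strongly_convex c z x y :
  0 < c -> moreau c z (2^-1 *: x + (1 - 2^-1) *: y)
    <= 2^-1 * moreau c z x + 2^-1 * moreau c z y - c / 8 * `|x - y| ^+ 2.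
Proof.
move=> c0; have H := @convex_segment x y 2^-1 ltac:(lra) ltac:(lra).
have E : `|2^-1 *: x + (1 - 2^-1) *: y - z| ^+ 2 =
   2^-1 * `|x - z| ^+ 2 + 2^-1 * `|y - z| ^+ 2 - 4^-1 * `|x - y| ^+ 2.
  rewrite !sqr_norm !innerE (innerC y x) (innerC z x) (innerC z y).
  by lra.
rewrite /moreau E; nra.
Qed.

Lemma moreau_continuous c z : continuous (moreau c z).
Proof.
move=> x; apply: cvgD; first exact: lipschitz_continuous.
apply: cvgMr; rewrite /= expr2.
by apply: cvgM; apply: cvg_norm; apply: cvgB => //; exact: cvg_cst.
Qed.

(** The direct method: a minimizing sequence is Cauchy
by strong convexity, and its limit is a minimizer by continuity. *)
Lemma moreau_minimizer c z : 0 < c ->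
  exists p, forall x, moreau c z p <= moreau c z x.
Proof.
move=> c0; pose J := moreau c z; pose m := inf (range J).
have hasm : has_inf (range J).
  split; first by exists (J 0), 0.
  exists (R z - `|L| ^+ 2 / (2 * c)) => _ [x _ <-].
  exact: moreau_lower_bound.
have mJ x : m <= J x by apply: (ge_inf hasm.2); exists x.
have ex n : exists x, J x < m + n.+1%:R^-1.
  have [|_ [x _ <-] ?] := @inf_adherent _ (range J) n.+1%:R^-1 _ hasm.
    by rewrite invr_gt0.
  by exists x.
pose u n := projT1 (cid (ex n)).
have Ju n : J (u n) < m + n.+1%:R^-1 := projT2 (cid (ex n)).
have u_dist n k : `|u n - u k| ^+ 2 <= 4 / c * (n.+1%:R^-1 + k.+1%:R^-1).
  have := moreau_strongly_convex z (u n) (u k) c0.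
  have := mJ (2^-1 *: u n + (1 - 2^-1) *: u k).
  have := Ju n; have := Ju k; rewrite /J => H1 H2 H3 H4.
  rewrite -(ler_pM2l (divr_gt0 c0 (ltr0n K 8))).
  have -> : c / 8 * (4 / c * (n.+1%:R^-1 + k.+1%:R^-1))
     = 2^-1 * (n.+1%:R^-1 + k.+1%:R^-1) by field; rewrite ?lt0r_neq0.
  move: (n.+1%:R^-1) (k.+1%:R^-1) H1 H2 H3 H4 => a b; lra.
have : cvgn u.
  apply/cauchy_cvgP/cauchy_ballP => e e0; near_simpl.
  have d0 : 0 < c / 8 * e ^+ 2 by rewrite mulr_gt0 ?exprn_gt0 ?divr_gt0.
  near=> nk; rewrite -ball_normE /=.
  have n0 : nk.1.+1%:R^-1 < c / 8 * e ^+ 2.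
    by near: nk; apply: (cvg_fst (near_infty_natSinv_lt (PosNum d0))).
  have k0 : nk.2.+1%:R^-1 < c / 8 * e ^+ 2.
    by near: nk; apply: (cvg_snd (near_infty_natSinv_lt (PosNum d0))).
  rewrite -(ltr_pXn2r (n := 2)) ?nnegrE ?(ltW e0) //.
  apply: (le_lt_trans (u_dist _ _)).
  have -> : e ^+ 2 = 4 / c * (c / 8 * e ^+ 2 + c / 8 * e ^+ 2).
    by field; rewrite ?lt0r_neq0.
  by rewrite ltr_pM2l ?divr_gt0 // ltrD.
move=> up; exists (lim (u @ \oo)) => x; apply: le_trans (mJ x).
have : J (u n) @[n --> \oo] --> J (lim (u @ \oo)).
  by apply: (cvg_comp _ _ up); exact: moreau_continuous.
have : m + n.+1%:R^-1 @[n --> \oo] --> m.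
  rewrite -[X in _ --> X]addr0; apply: cvgD; first exact: cvg_cst.
  exact: cvg_harmonic.
move=> hm hJ; apply: (ler_cvg_to hJ hm); apply: nearW => n; exact: ltW.
Unshelve. all: by end_near. Qed.

(** The optimality condition of the minimizer [p]: the point [c *: (z - p)] is a
subgradient of the function at [p].  Moving from [p] towards [x] by a step [s]
can only increase the objective; dividing by [s] and letting it tend to 0
leaves the inequality. *)
Lemma proximal_point c z : 0 < c ->
  exists p, forall x, R p + c * inner (z - p) (x - p) <= R x.
Proof.
move=> c0; have [p minp] := moreau_minimizer z c0; exists p => x.
set B := c / 2 * `|x - p| ^+ 2.
have B0 : 0 <= B by rewrite mulr_ge0 ?sqr_ge0 // divr_ge0 // ltW.
have key s : 0 < s -> s <= 1 ->
    R p + c * inner (z - p) (x - p) - R x <= s * B.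
  move=> s0 s1; have := minp (s *: x + (1 - s) *: p).
  have := @convex_segment x p s (ltW s0) s1.
  rewrite /moreau /B !sqr_norm => H1 H2; rewrite -(ler_pM2l s0).
  have E : inner (s *: x + (1 - s) *: p - z) (s *: x + (1 - s) *: p - z) =
     inner (p - z) (p - z) - 2 * s * inner (z - p) (x - p)
      + s ^+ 2 * inner (x - p) (x - p).
    rewrite !innerE (innerC p x) (innerC z x) (innerC z p); ring.
  rewrite E in H2; nra.
apply/ler_addgt0Pr => e e0.
have d0 : 0 < B + e + 1 by lra.
(* This step is at most 1 and makes the error term [s * B] at most [e]. *)
have := key (e / (B + e + 1)) (divr_gt0 e0 d0).
rewrite ler_pdivrMr // => /(_ ltac:(lra)).
suff : e / (B + e + 1) * B <= e by lra.
by rewrite mulrAC ler_pdivrMr //; nra.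
Qed.

End ProximalPoint.

(** * The adjoint and the operator norm *)

Section Adjoint.
Variables (K : realType) (W X : hilbertType K) (T : {linear W -> X}).
Hypothesis T_bounded : bounded_operator T.

(** The Riesz representation of [w |-> <T w, x>]: the proximal point of the
negative of this functional at the origin is its representative. *)
Lemma adjointP x w : inner (T w) x = inner w (adjoint T x).
Proof.
suff [z hz] : exists z, forall w, inner (T w) x = inner w z.
  exact: (@getI _ [set z | forall w, inner (T w) x = inner w z] z hz w).
have [M TM] := T_bounded.
pose l (v : W) : K := - inner (T v) x.
have l_convex : convex_function [set: W] l.
  move=> s u v _ _; rewrite /l.
  change (- inner (T (s%:num *: u + (1 - s%:num) *: v)) x
    <= s%:num * - inner (T u) x + (1 - s%:num) * - inner (T v) x).
  by rewrite linearD !linearZ !innerE opprD !mulrN.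
have l_lipschitz : (M * `|x|).-lipschitz l.
  move=> [u v] _ /=; rewrite /l -opprD normrN.
  rewrite -innerNl -innerDl -linearN -linearD.
  by rewrite (le_trans (norm_inner_le _ _)) // mulrAC ler_wpM2r.
have [z hz] := proximal_point l_convex l_lipschitz 0 ltr01.
have le_z v : inner (T v) x <= inner v z.
  have := hz (z + v); rewrite /l linearD sub0r mul1r.
  rewrite -(addrC v) addrK !innerE (innerC z v); lra.
exists z => v; apply/eqP; rewrite eq_le le_z /=.
by have := le_z (- v); rewrite linearN !innerE lerN2.
Qed.

Lemma adjointB x y : adjoint T (x - y) = adjoint T x - adjoint T y.
Proof.
apply/eqP; rewrite -subr_eq0; apply/eqP/inner_eq0.
by rewrite !(innerDr, innerNr) -!adjointP !(innerDr, innerNr); lra.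
Qed.

Lemma opnorm_ubound w : `|w| <= 1 -> `|T w| <= opnorm T.
Proof.
move=> w1; apply: sup_upper_bound; last by exists w.
have [M TM] := T_bounded; split.
  by exists `|T 0|, 0 => //=; rewrite normr0.
exists `|M| => _ [v /= v1 <-]; apply: (le_trans (TM v)).
apply: (@le_trans _ _ (`|M| * `|v|)); first by rewrite ler_wpM2r ?ler_norm.
by rewrite -[leRHS]mulr1 ler_wpM2l.
Qed.

Lemma opnorm_ge0 : 0 <= opnorm T.
Proof. by apply: le_trans (@opnorm_ubound 0 _); rewrite ?normr0. Qed.

Lemma opnorm_le w : `|T w| <= opnorm T * `|w|.
Proof.
have [->|w0] := eqVneq w 0; first by rewrite linear0 !normr0 mulr0.
have nw : 0 < `|w| by rewrite normr_gt0.
rewrite -ler_pdivrMr // mulrC -[`|w|^-1]ger0_norm ?invr_ge0 //.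
rewrite -normrZ -linearZ opnorm_ubound //.
by rewrite normrZ ger0_norm ?invr_ge0 // mulVf // gt_eqF.
Qed.

Lemma adjoint_norm_le x : `|adjoint T x| <= opnorm T * `|x|.
Proof.
have [->|z0] := eqVneq (adjoint T x) 0.
  by rewrite normr0 mulr_ge0 // opnorm_ge0.
have nz : 0 < `|adjoint T x| by rewrite normr_gt0.
rewrite -(ler_pM2l nz) -expr2 sqr_norm -adjointP.
apply: (le_trans (inner_le_norm _ _)).
by rewrite mulrCA mulrA ler_wpM2r // opnorm_le.
Qed.

End Adjoint.

(** * The convex conjugate and its proximal map *)

Section Conjugate.
Variables (K : realType) (X : hilbertType K) (R : X -> K).
Implicit Types (mu x : X).

Lemma fenchel_young mu x : ((inner mu x - R x)%:E <= conjugate R mu)%E.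
Proof. by apply: ereal_sup_ubound; exists x. Qed.

Lemma conjugate_fin_num mu : edom (conjugate R) mu ->
  conjugate R mu \is a fin_num.
Proof.
move=> mudom; rewrite fin_real // mudom andbT.
exact: lt_le_trans (ltNyr _) (fenchel_young mu 0).
Qed.

Lemma fine_fenchel_young mu x : edom (conjugate R) mu ->
  inner mu x - R x <= fine (conjugate R mu).
Proof.
by move=> mudom; rewrite -lee_fin fineK ?conjugate_fin_num // fenchel_young.
Qed.

Definition subgradient mu x := forall z, R x + inner mu (z - x) <= R z.

Lemma subgradient_conjugate mu x : subgradient mu x ->
  conjugate R mu = (inner mu x - R x)%:E.
Proof.
move=> sub; apply/eqP; rewrite eq_le fenchel_young andbT.
apply: ge_ereal_sup => _ [z _ <-]; rewrite lee_fin.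
by have := sub z; rewrite !innerE; lra.
Qed.

Lemma subgradient_edom mu x : subgradient mu x -> edom (conjugate R) mu.
Proof. by move=> /subgradient_conjugate E; rewrite /edom /= E ltry. Qed.

Variable L : K.
Hypothesis R_convex : convex_function [set: X] R.
Hypothesis R_lipschitz : L.-lipschitz R.

(** If [`|mu| > `|L|], then [<mu, x> - R x] grows without bound along the ray
through [mu]. *)
Lemma edom_conjugate_norm_le mu : edom (conjugate R) mu -> `|mu| <= `|L|.
Proof.
move=> mudom; rewrite leNgt; apply/negP => lt_L_mu.
set C := fine (conjugate R mu).
have n0 : 0 < `|mu| by exact: le_lt_trans lt_L_mu.
have d0 : 0 < `|mu| * (`|mu| - `|L|) by rewrite mulr_gt0 // subr_gt0.
have key s : 0 < s -> s * (`|mu| * (`|mu| - `|L|)) <= C + R 0.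
  move=> s0; have := fine_fenchel_young (s *: mu) mudom; rewrite -/C.
  have := lipschitz_le_abs R_lipschitz (s *: mu) 0.
  rewrite subr0 normrZ gtr0_norm // innerZr -sqr_norm; nra.
have p0 : 0 < (`|C + R 0| + 1) by rewrite ltr_wpDl.
(* Along the ray this parameter makes the growth exceed its bound by 1 or
   more. *)
have := key _ (divr_gt0 p0 d0); rewrite divfK ?gt_eqF //.
have := ler_norm (C + R 0); lra.
Qed.

(** Moreau decomposition: if [x] is the proximal point of R at [gamma^-1 *: nu]
with weight [gamma], then [p := nu - gamma *: x] is a subgradient of R at [x].
Hence [R^*] is minorized by an affine function that touches it at [p] and has
slope [x], so that the proximal objective exceeds its value at [p] by at least
[`|mu' - p| ^+ 2 / (2 * gamma)]; in particular [p] is its only minimizer. *)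
Lemma proxP gamma nu : 0 < gamma ->
  let mu := prox gamma (conjugate R) nu in
  exists2 x, subgradient mu x & nu = mu + gamma *: x.
Proof.
move=> g0 mu.
have [x hx] := proximal_point R_convex R_lipschitz (gamma^-1 *: nu) g0.
have [p Enu] : exists p, nu = p + gamma *: x.
  by exists (nu - gamma *: x); rewrite subrK.
have sub_p : subgradient p x.
  move=> z; apply: le_trans (hx z).
  rewrite Enu lerD2l -innerZl scalerBr scalerA divff ?lt0r_neq0 //.
  by rewrite scale1r addrK.
have gap_p mu' : (prox_objective gamma (conjugate R) nu p
    + ((2 * gamma)^-1 * `|mu' - p| ^+ 2)%:E
    <= prox_objective gamma (conjugate R) nu mu')%E.
  rewrite /prox_objective (subgradient_conjugate sub_p) -!EFinD.
  apply: le_trans (leeD2r _ (fenchel_young mu' x)); rewrite -EFinD lee_fin.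
  rewrite le_eqVlt; apply/orP; left; apply/eqP.
  have -> : mu' - nu = (mu' - p) - gamma *: x.
    by rewrite Enu opprD addrA.
  have -> : p - nu = - (gamma *: x) by rewrite Enu opprD addrA subrr add0r.
  rewrite !sqr_norm !innerE (innerC x mu') (innerC x p) (innerC mu' p).
  field; exact: lt0r_neq0.
have fin_p : prox_objective gamma (conjugate R) nu p \is a fin_num.
  by rewrite /prox_objective (subgradient_conjugate sub_p).
have min_p mu' : (prox_objective gamma (conjugate R) nu p
    <= prox_objective gamma (conjugate R) nu mu')%E.
  apply: le_trans (gap_p mu'); rewrite leeDl // lee_fin.
  by rewrite mulr_ge0 ?sqr_ge0 // invr_ge0 mulr_ge0 // ltW.
suff mu_p : mu = p by exists x; rewrite mu_p.
have min_mu : (prox_objective gamma (conjugate R) nu mu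
    <= prox_objective gamma (conjugate R) nu p)%E.
  exact: (@getI _ [set p | forall mu', (prox_objective gamma (conjugate R) nu p
    <= prox_objective gamma (conjugate R) nu mu')%E] p min_p p).
have := le_trans (gap_p mu) min_mu.
rewrite -(fineK fin_p) -EFinD lee_fin gerDl.
rewrite pmulr_rle0 ?invr_gt0 ?mulr_gt0 // sqr_norm.
by move=> /inner_eq0 /eqP; rewrite subr_eq0 => /eqP.
Qed.

(** The exact subgradient [c *: (x - p)] at the proximal point [p] of [x] is an
approximate one at [x], because it has norm at most [`|L|] and [p] tends to [x]
as the weight [c] grows. *)
Lemma approximate_subgradient x e : 0 < e -> exists2 mu,
  edom (conjugate R) mu & fine (conjugate R mu) <= inner mu x - R x + e.
Proof.
move=> e0.
(* From [c * `|x - p| <= `|L|], the error [`|L| * `|x - p|] is at most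
   [`|L| ^+ 2 / c]; the added 1 keeps the weight positive. *)
pose c := (`|L| ^+ 2 + 1) / e.
have L0 : 0 < `|L| ^+ 2 + 1 by rewrite ltr_wpDl ?sqr_ge0.
have c0 : 0 < c by rewrite divr_gt0.
have [p hp] := proximal_point R_convex R_lipschitz x c0.
have sub : subgradient (c *: (x - p)) p by move=> z; rewrite innerZl hp.
exists (c *: (x - p)); first exact: subgradient_edom sub.
rewrite (subgradient_conjugate sub) /=.
have := edom_conjugate_norm_le (subgradient_edom sub).
rewrite normrZ gtr0_norm // => Hn.
have H := lipschitz_le_abs R_lipschitz x p.
have E : inner (c *: (x - p)) x - inner (c *: (x - p)) p = c * `|x - p| ^+ 2.
  by rewrite sqr_norm -innerZl -innerNr -innerDr.
have : `|L| * `|x - p| <= e.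
  rewrite -(ler_pM2l c0) mulrCA {2}/c divfK ?gt_eqF //.
  apply: (@le_trans _ _ (`|L| * `|L|)); first by rewrite ler_wpM2l.
  by rewrite -expr2 lerDl.
have : 0 <= c * `|x - p| ^+ 2 by rewrite mulr_ge0 ?sqr_ge0 // ltW.
lra.
Qed.

End Conjugate.

(** * Gap estimate for the dual proximal gradient iteration *)

Section ProximalGradient.
Variables (K : realType) (W X : hilbertType K).
Variables (T : {linear W -> X}) (R : X -> K) (L : K).
Hypothesis T_bounded : bounded_operator T.
Hypothesis R_convex : convex_function [set: X] R.
Hypothesis R_lipschitz : L.-lipschitz R.
Variables (q : W) (t gamma : K) (mu0 : X).
Hypotheses (t_gt0 : 0 < t) (gamma_gt0 : 0 < gamma).

Let H mu := t / 2 * `|adjoint T mu| ^+ 2 - inner mu (T q)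
  + fine (conjugate R mu).

Lemma dual_objectiveE mu : edom (conjugate R) mu ->
  dual_objective T R q t mu = (H mu)%:E.
Proof.
move=> mudom; rewrite /dual_objective.
by rewrite -[in LHS](fineK (conjugate_fin_num mudom)).
Qed.

Lemma gapE y mu : edom (conjugate R) mu ->
  gap T R q t y mu = (primal_objective T R q t y + H mu)%:E.
Proof. by move=> mudom; rewrite /gap dual_objectiveE. Qed.

(** Weak duality: Fenchel-Young for [R], and the quadratic terms complete to
the square of [y - q + t *: adjoint T mu]. *)
Lemma gap_ge0 y mu : edom (conjugate R) mu -> (0 <= gap T R q t y mu)%E.
Proof.
move=> mudom; rewrite gapE // lee_fin /primal_objective /H.
have := fine_fenchel_young (T y) mudom.
have : 0 <= (2 * t)^-1 * `|y - q + t *: adjoint T mu| ^+ 2.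
  by rewrite mulr_ge0 ?sqr_ge0 // invr_ge0 mulr_ge0 // ltW.
have -> : (2 * t)^-1 * `|y - q + t *: adjoint T mu| ^+ 2 =
  (2 * t)^-1 * `|y - q| ^+ 2 + (inner mu (T y) - inner mu (T q))
    + t / 2 * `|adjoint T mu| ^+ 2.
  rewrite !(innerC mu) !(adjointP T_bounded).
  move: (adjoint T mu) => z; rewrite !sqr_norm !innerE (innerC q y).
  rewrite (innerC z y) (innerC z q); field; exact: lt0r_neq0.
lra.
Qed.

Hypothesis step_size : gamma * t * opnorm T ^+ 2 <= 1.

(** The quadratic part of the dual objective is its own remainder in a
first-order expansion, so this is the descent condition on [gamma]. *)
Lemma dual_smoothness mu :
  t / 2 * `|adjoint T mu| ^+ 2 <= (2 * gamma)^-1 * `|mu| ^+ 2.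
Proof.
have : `|adjoint T mu| ^+ 2 <= (opnorm T * `|mu|) ^+ 2.
  by rewrite lerXn2r ?nnegrE ?mulr_ge0 ?opnorm_ge0 // adjoint_norm_le.
move=> H1; apply: (@le_trans _ _ (t / 2 * (opnorm T * `|mu|) ^+ 2)).
  by rewrite ler_wpM2l // divr_ge0 // ltW.
rewrite exprMn mulrA ler_wpM2r ?sqr_ge0 //.
rewrite -(ler_pM2l (mulr_gt0 (ltr0n K 2) gamma_gt0)).
rewrite divff ?lt0r_neq0 ?mulr_gt0 //.
have -> // : 2 * gamma * (t / 2 * opnorm T ^+ 2) = gamma * t * opnorm T ^+ 2.
by field.
Qed.

Let mu := dual_iterate T R q t gamma mu0.
Let y := primal_iterate T R q t gamma mu0.
Let ybar := primal_average T R q t gamma mu0.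
Hypothesis mu0_dom : edom (conjugate R) mu0.

Lemma primal_iterate_dist j :
  `|y j - q| ^+ 2 = t ^+ 2 * `|adjoint T (mu j)| ^+ 2.
Proof.
by rewrite /y /primal_iterate /primal_of_dual addrAC subrr add0r normrN normrZ
  exprMn gtr0_norm.
Qed.

Lemma dual_iterate_edom j : edom (conjugate R) (mu j).
Proof.
case: j => [//|j].
have [x sub _] :=
  proxP R_convex R_lipschitz (mu j + gamma *: T (y j)) gamma_gt0.
exact: subgradient_edom sub.
Qed.

(** With [x] the subgradient of [R^*] at [mu j.+1] given by the proximal step,
[R^* nu >= <nu, x> - R x] and [R^* (mu j.+1) = <mu j.+1, x> - R x]; substituting
[x = T (y j) + gamma^-1 *: (mu j - mu j.+1)] leaves a three-point identity and
the remainder controlled by [dual_smoothness]. *)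
Lemma proximal_gradient_step j nu : edom (conjugate R) nu ->
  (2 * t)^-1 * `|y j - q| ^+ 2 + inner nu (T (y j)) - fine (conjugate R nu)
    + H (mu j.+1)
  <= (2 * gamma)^-1 * (`|nu - mu j| ^+ 2 - `|nu - mu j.+1| ^+ 2).
Proof.
move=> nudom.
have [x sub] := proxP R_convex R_lipschitz (mu j + gamma *: T (y j)) gamma_gt0.
rewrite -[prox _ _ _]/(mu j.+1) => E.
have := fine_fenchel_young x nudom.
have := dual_smoothness (mu j - mu j.+1).
have {}sub : subgradient R (mu j.+1) x := sub.
rewrite /H (subgradient_conjugate sub) /=.
have Ey : y j = q - t *: adjoint T (mu j) by [].
have Ex : x = T (y j) + gamma^-1 *: (mu j - mu j.+1).
  apply: (scalerI (lt0r_neq0 gamma_gt0)).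
  rewrite scalerDr scalerA divff ?lt0r_neq0 // scale1r.
  by rewrite addrA [_ + mu j]addrC E addrC addKr.
rewrite primal_iterate_dist Ex Ey linearB linearZ /= (adjointB T_bounded).
rewrite !(innerDr, innerNr, innerZr) !(innerC _ (T _)) !(adjointP T_bounded).
move: (mu j) (mu j.+1) => a b; rewrite !sqr_norm.
move: (adjoint T a) (adjoint T b) => za zb.
rewrite !innerE (innerC b a) (innerC a nu) (innerC b nu) (innerC zb za).
have -> : (2 * t)^-1 * (t ^+ 2 * inner za za) = t / 2 * inner za za.
  by field; exact: lt0r_neq0.
rewrite invfM; move: (fine _) (gamma^-1) => A g; lra.
Qed.

(** The case [nu := mu j] of the one-step inequality, where the Lagrangian term
is exactly [- H (mu j)]. *)
Lemma dual_objective_nonincreasing j : H (mu j.+1) <= H (mu j).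
Proof.
have := proximal_gradient_step j (dual_iterate_edom j).
rewrite subrr normr0 expr0n /= sub0r mulrN.
have : 0 <= (2 * gamma)^-1 * `|mu j - mu j.+1| ^+ 2.
  by rewrite mulr_ge0 ?sqr_ge0 // invr_ge0 mulr_ge0 // ltW.
suff -> : (2 * t)^-1 * `|y j - q| ^+ 2 + inner (mu j) (T (y j))
    - fine (conjugate R (mu j)) = - H (mu j) by lra.
have Ey : y j = q - t *: adjoint T (mu j) by [].
rewrite /H primal_iterate_dist Ey.
rewrite linearB linearZ !(innerDr, innerNr, innerZr).
rewrite (innerC (mu j) (T (adjoint T (mu j)))) (adjointP T_bounded) /=.
rewrite !sqr_norm.
by field; exact: lt0r_neq0.
Qed.

(** Telescoped one-step inequalities; monotonicity of H allows all its values
to be replaced by the last one. *)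
Lemma proximal_gradient_sum j nu : edom (conjugate R) nu ->
  (2 * t)^-1 * (\sum_(i < j) `|y i - q| ^+ 2)
    + inner nu (T (\sum_(i < j) y i))
    + j%:R * (H (mu j) - fine (conjugate R nu))
  <= (2 * gamma)^-1 * (`|nu - mu0| ^+ 2 - `|nu - mu j| ^+ 2).
Proof.
move=> nudom; elim: j => [|j IH].
  by rewrite !big_ord0 linear0 inner0r !mulr0 mul0r subrr mulr0 !addr0.
rewrite !big_ord_recr /= linearD innerDr.
have := proximal_gradient_step j nudom.
have : j%:R * H (mu j.+1) <= j%:R * H (mu j).
  by rewrite ler_wpM2l // dual_objective_nonincreasing.
rewrite -[j.+1%:R]natr1; move: IH; lra.
Qed.

(** For [nu] a subgradient of R at [T (ybar j)], the left-hand side is the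
gap. *)
Lemma averaged_gap_estimate j nu : (0 < j)%N -> edom (conjugate R) nu ->
  (2 * t)^-1 * `|ybar j - q| ^+ 2 + inner nu (T (ybar j))
    - fine (conjugate R nu) + H (mu j)
  <= `|nu - mu0| ^+ 2 / (2 * gamma * j%:R).
Proof.
move=> j0 nudom.
have jK : 0 < j%:R :> K by rewrite ltr0n.
have sum_y : \sum_(i < j) y i = j%:R *: ybar j.
  by rewrite scalerA divff ?scale1r // gt_eqF.
have -> : `|nu - mu0| ^+ 2 / (2 * gamma * j%:R)
  = (2 * gamma)^-1 * `|nu - mu0| ^+ 2 / j%:R.
  by rewrite invfM mulrA [_ / (2 * gamma)]mulrC.
rewrite ler_pdivlMr //.
have := proximal_gradient_sum j nudom.
rewrite sum_y linearZ innerZr /=.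
have avg : j%:R * `|ybar j - q| ^+ 2 <= \sum_(i < j) `|y i - q| ^+ 2.
  exact: sqr_norm_average.
have t2 : 0 <= (2 * t)^-1 by rewrite invr_ge0 mulr_ge0 // ltW.
have := ler_wpM2l t2 avg.
have : 0 <= (2 * gamma)^-1 * `|nu - mu j| ^+ 2.
  by rewrite mulr_ge0 ?sqr_ge0 // invr_ge0 mulr_ge0 // ltW.
move: (\sum_(i < j) _) ((2 * t)^-1) ((2 * gamma)^-1) => s u v; lra.
Qed.

Lemma domain_distance_le nu : edom (conjugate R) nu ->
  `|nu - mu0| ^+ 2 <= (`|mu0| + L) ^+ 2.
Proof.
move=> nudom.
have nuL := edom_conjugate_norm_le R_lipschitz nudom.
have [L0|L0] := leP 0 L.
  rewrite lerXn2r ?nnegrE ?addr_ge0 //.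
  rewrite (le_trans (ler_normB _ _)) // addrC lerD2l.
  by rewrite ger0_norm in nuL.
suff -> : nu - mu0 = 0 by rewrite normr0 expr0n sqr_ge0.
exact: lipschitz_neg_trivial R_lipschitz _ L0.
Qed.

Lemma gap_le_bound j : (0 < j)%N ->
  (gap T R q t (ybar j) (mu j)
     <= ((`|mu0| + L) ^+ 2 / (2 * gamma * j%:R))%:E)%E.
Proof.
move=> j0; rewrite (gapE _ (dual_iterate_edom j)) lee_fin.
apply/ler_addgt0Pr => e e0.
have [nu nudom nu_le] :=
  approximate_subgradient R_convex R_lipschitz (T (ybar j)) e0.
have := averaged_gap_estimate j0 nudom.
have : `|nu - mu0| ^+ 2 / (2 * gamma * j%:R)
    <= (`|mu0| + L) ^+ 2 / (2 * gamma * j%:R).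
  rewrite ler_wpM2r ?domain_distance_le // invr_ge0.
  by rewrite !mulr_ge0 // ltW.
rewrite /primal_objective; lra.
Qed.

Lemma bound_le j : (0 < j)%N ->
  (`|mu0| + L) ^+ 2 / (2 * gamma * j%:R) <= 2 * L ^+ 2 / (gamma * j%:R).
Proof.
move=> j0; have jK : 0 < j%:R :> K by rewrite ltr0n.
have d0 : 0 < gamma * j%:R by rewrite mulr_gt0.
have -> : 2 * L ^+ 2 / (gamma * j%:R) = (4 * L ^+ 2) / (2 * gamma * j%:R).
  by field; rewrite !lt0r_neq0.
rewrite ler_wpM2r ?invr_ge0 ?mulr_ge0 ?(ltW gamma_gt0) //.
have n0 := edom_conjugate_norm_le R_lipschitz mu0_dom.
have [L0|L0] := leP 0 L.
  by rewrite ger0_norm // in n0; have := normr_ge0 mu0; nra.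
rewrite (lipschitz_neg_trivial R_lipschitz mu0 L0) normr0 add0r.
by have := sqr_ge0 L; lra.
Qed.

End ProximalGradient.

(** * Vanishing of the gap *)

Lemma harmonic_bound_cvg0 (K : realType) (a b : K) :
  a / (b * n.+1%:R) @[n --> \oo] --> (0 : K).
Proof.
rewrite (_ : (fun n => _) = (fun n => a / b * n.+1%:R^-1)).
  rewrite -(mulr0 (a / b)); apply: cvgMr; exact: cvg_harmonic.
by apply/funext => n; rewrite invfM mulrA.
Qed.

Theorem theorem5p4 (K : realType) (W X : hilbertType K)
    (T : {linear W -> X}) (R : X -> K) (L : K)
    (T_bounded : bounded_operator T)
    (R_convex : convex_function [set: X] R)
    (R_lipschitz : L.-lipschitz R) :
  (forall (q : W) (t gamma : K) (mu0 : X),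
     0 < t -> 0 < gamma -> gamma * t * opnorm T ^+ 2 <= 1 ->
     edom (conjugate R) mu0 ->
   forall j : nat, (0 < j)%N ->
   let mu := dual_iterate T R q t gamma mu0 in
   let ybar := primal_average T R q t gamma mu0 in
   [/\ (0 <= gap T R q t (ybar j) (mu j))%E,
       (gap T R q t (ybar j) (mu j)
          <= ((`|mu0| + L) ^+ 2 / (2 * gamma * j%:R))%:E)%E &
       (`|mu0| + L) ^+ 2 / (2 * gamma * j%:R)
          <= 2 * L ^+ 2 / (gamma * j%:R)])
  /\
  (forall (f : W -> K) (gamma : W -> K -> K) (mu0 : W -> K -> X),
     C1_lipschitz_gradient f ->
     (forall q t, 0 < t ->
        [/\ 0 < gamma q t,
            gamma q t * t * opnorm T ^+ 2 <= 1 &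
            edom (conjugate R) (mu0 q t)]) ->
   inner_approximation T R f
     (fun q t n => (primal_average T R q t (gamma q t) (mu0 q t) n.+1,
                    dual_iterate T R q t (gamma q t) (mu0 q t) n.+1))
     (fun q t n => (`|mu0 q t| + L) ^+ 2 / (2 * gamma q t * n.+1%:R))).
Proof.
split=> [q t gamma mu0 t0 g0 step mu0_dom j j0 mu ybar|f gamma mu0 _ params].
  split.
  - apply: (gap_ge0 T_bounded q t0).
    exact: (dual_iterate_edom T R_convex R_lipschitz q t g0 mu0_dom).
  - exact: gap_le_bound.
  - exact: (bound_le R_lipschitz g0 mu0_dom).
move=> w t _ t0 q g; have [g0 step mu0_dom] := params q t t0.
have dom n := dual_iterate_edom T R_convex R_lipschitz q t g0 mu0_dom n.
have g_ge0 n : (0 <= g n)%E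
  by exact: (gap_ge0 T_bounded q t0 _ (dom n.+1)).
have g_le n : (g n <= ((`|mu0 q t| + L) ^+ 2 / (2 * gamma q t * n.+1%:R))%:E)%E.
  exact: (gap_le_bound T_bounded R_convex R_lipschitz q t0 g0 step mu0_dom).
have b_cvg := @harmonic_bound_cvg0 K ((`|mu0 q t| + L) ^+ 2) (2 * gamma q t).
split=> //.
  by move=> n; rewrite /g (gapE T q t _ (dom n.+1)).
apply: (@squeeze_cvge _ _ _ _ (cst 0%E) _
  (fun n => ((`|mu0 q t| + L) ^+ 2 / (2 * gamma q t * n.+1%:R))%:E)).
- by apply: nearW => n; rewrite g_ge0 g_le.
- exact: cvg_cst.
- by apply: cvg_EFin => //; exact: nearW.
Qed.
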